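(* Let $\alpha$ be a complex parameter in the modular strip. Classify the reflections of a reflection group $W$ up to the relation that their hyperplanes of fixed points lie in the same $W$-orbit, and call the resulting classes conjugacy classes. Then there are exactly four conjugacy classes in $[G(2,1,1)]_1^\alpha\simeq[W(A_1)]^\alpha$. For $n\ge2$, there are exactly five conjugacy classes in $[G(2,1,n)]_1^\alpha$ and a single conjugacy class in $[W(A_n)]^\alpha$.
   Context: The modular strip is the standard fundamental domain of $SL_2(\mathbb Z)$ acting on the upper half-plane, so in particular $\operatorname{Im}\alpha>0$. Put $\Lambda_\alpha=\mathbb Z+\alpha\mathbb Z\subset\mathbb C$. $[G(2,1,n)]_1^\alpha$ ($n\ge1$) is the group of affine transformations $z\mapsto gz+t$ of $\mathbb C^n$ with $g\in G(2,1,n)$ (signed $n\times n$ permutation matrices) and $t\in\Lambda_\alpha^n$. $[W(A_n)]^\alpha$ ($n\ge1$) is the group of affine transformations $z\mapsto gz+t$ of $V=\{z\in\mathbb C^{n+1}: z_1+\dots+z_{n+1}=0\}$ with $g\in\mathfrak S_{n+1}$ (permuting coordinates) and $t\in\Lambda_\alpha^{n+1}\cap V$. A reflection is a non-identity affine transformation of finite order fixing pointwise a complex affine hyperplane. All reflections in these groups have order 2. *)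

(* Defs.v *)
From HB Require Import structures.
From mathcomp Require Import all_boot all_order all_fingroup all_algebra.
From mathcomp Require Import boolp classical_sets functions cardinality reals.
From mathcomp Require Import complex.

Set Implicit Arguments.
Unset Strict Implicit.
Unset Printing Implicit Defensive.

Import Order.TTheory GRing.Theory Num.Theory.
Local Open Scope classical_set_scope.
Local Open Scope ring_scope.

Section AffineReflections.
Variable K : fieldType.

Definition is_affine (E F : vectType K) (f : E -> F) : Prop :=
  exists (g : 'Hom(E, F)) (t : F), forall z, f z = g z + t.

Definition affine_hyperplane (E : vectType K) (A : set E) : Prop :=
  exists (p : E) (H : {vspace E}),
    (\dim H).+1 = \dim {: E} /\ A = [set z | z - p \in H].

Definition finite_order (T : Type) (f : T -> T) : Prop :=
  exists2 k, (0 < k)%N & iter k f =1 id.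

Definition fixed_points (T : Type) (f : T -> T) : set T := [set z | f z = z].

Definition is_reflection (E : vectType K) (f : E -> E) : Prop :=
  [/\ is_affine f, f <> id, finite_order f
    & exists2 A, affine_hyperplane A & A `<=` fixed_points f].

Definition reflections (E : vectType K) (W : set (E -> E)) : set (E -> E) :=
  [set s | W s /\ is_reflection s].

(* The fixed-point set of a reflection is exactly its hyperplane, since the
   reflection is not the identity. *)
Definition same_class (E : vectType K) (W : set (E -> E)) (s s' : E -> E)
    : Prop :=
  exists2 w, W w & w @` fixed_points s = fixed_points s'.

Definition reflection_class (E : vectType K) (W : set (E -> E)) (s : E -> E)
    : set (E -> E) :=
  [set s' | reflections W s' /\ same_class W s s'].

Definition reflection_classes (E : vectType K) (W : set (E -> E))
    : set (set (E -> E)) :=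
  reflection_class W @` reflections W.

(* Isomorphism as groups of affine transformations: a group isomorphism theta
   together with an affine isomorphism phi of the underlying spaces which is
   equivariant along theta. *)
Definition affine_group_iso (E F : vectType K)
    (W : set (E -> E)) (W' : set (F -> F)) : Prop :=
  exists (theta : (E -> E) -> (F -> F)) (phi : E -> F),
    [/\ set_bij W W' theta,
        (forall g h, W g -> W h -> theta (g \o h) = theta g \o theta h),
        is_affine phi, bijective phi
      & forall g, W g -> theta g \o phi = phi \o g].

End AffineReflections.

Section Crystallographic.
Variable R : realType.
Local Notation C := R[i].

(* The closed fundamental domain: it contains every half-open variant. *)
Definition modular_strip : set C :=
  [set a | [/\ 0 < complex.Im a, `|complex.Re a| <= 2^-1 & 1 <= `|a|]].

Definition lattice (alpha : C) : set C :=
  [set x | exists a b : int, x = a%:~R + b%:~R * alpha].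

Definition lattice_vec (alpha : C) (n : nat) : set 'cV[C]_n :=
  [set t | forall i, lattice alpha (t i 0)].

(* G(2,1,n): the signed permutation matrices. *)
Definition G21 (n : nat) : set 'M[C]_n :=
  [set g | exists (e : 'I_n -> bool) (s : 'S_n),
     g = diag_mx (\row_i (-1) ^+ e i) *m perm_mx s].

(* [G(2,1,n)]_1^alpha *)
Definition crystG21 (alpha : C) (n : nat) : set ('cV[C]_n -> 'cV[C]_n) :=
  [set f | exists g t, [/\ G21 g, lattice_vec alpha t
     & forall z, f z = g *m z + t]].

Definition sum0_space (n : nat) : {vspace 'cV[C]_n} :=
  lker (linfun (mulmx (const_mx 1 : 'rV[C]_n))).

Lemma mem_sum0_space n (z : 'cV[C]_n) :
  (z \in sum0_space n) = (\sum_i z i 0 == 0).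
Proof.
rewrite memv_ker lfunE /=; apply/eqP/eqP => [/matrixP/(_ 0 0)|h].
  by rewrite !mxE => h; rewrite -[RHS]h; apply: eq_bigr => i _;
     rewrite mxE mul1r.
apply/matrixP => i j; rewrite !ord1 !mxE -[RHS]h.
by apply: eq_bigr => k _; rewrite mxE mul1r.
Qed.

(* [W(A_n)]^alpha, acting on the hyperplane of sum zero in C^(n+1). *)
Definition crystA (alpha : C) (n : nat)
    : set (subvs_of (sum0_space n.+1) -> subvs_of (sum0_space n.+1)) :=
  [set f | exists (s : 'S_n.+1) (t : 'cV[C]_n.+1),
     [/\ t \in sum0_space n.+1, lattice_vec alpha t
       & forall z, vsval (f z) = perm_mx s *m vsval z + t]].

End Crystallographic.

Arguments crystG21 {R} alpha n _.
Arguments crystA {R} alpha n _.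

(* Main.v *)
Require Import Defs.
From HB Require Import structures.
From mathcomp Require Import all_boot all_order all_fingroup all_algebra.
From mathcomp Require Import boolp classical_sets functions cardinality reals.
From mathcomp Require Import complex.
From mathcomp Require Import zify ring.

(** The hyperplane of a reflection decides its class, so the classes are counted
by classifying hyperplanes up to the group.

Every group element sends z to a vector whose i-th coordinate is
e_i z_(p i) + t_i, with e_i a sign, p a permutation and t_i in the lattice L.
If such a map s is a reflection, some coordinate equation
z_i = e_i z_(p i) + t_i is not an identity; its solution set contains the fixed
points of s, hence the hyperplane of s, and is itself a hyperplane, so all
three coincide.  The reflecting hyperplanes are therefore of the form 2 z_i = c
or z_i - e z_j = c with c in L ([crystG21_fixed], [crystA_fixed]), and each of
these equations does define a reflecting hyperplane ([symmetry_reflection]).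

- For G(2,1,n), an element of the group turns the equation 2 z_i = c into
  2 z_j = +-c + 2 t with t in L.  Since c and -c agree modulo 2L, the class of c
  in L/2L is the only invariant; L/2L has four elements because L is free of
  rank two, which uses that alpha is not real.  The hyperplanes z_i - e z_j = c
  (present for n >= 2 only) form one orbit: translating along the i-th
  coordinate gives c any value in L and changing one sign gives e any value.
- For A_n, the equation is z_i - z_j = c, and translations by t change c by
  t_i - t_j, where t ranges over vectors of L^(n+1) with sum zero.  For n >= 2 a
  third coordinate can absorb the sum, so t_i - t_j is an arbitrary element of L
  and there is one orbit.  For n = 1 one has t_j = - t_i, so c moves by 2 t_i
  and again the orbits are the four elements of L/2L.

The isomorphism of the two rank-one groups is conjugation by the linear map
z |-> (z, -z) ([crystG21_crystA_iso]). *)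

Set Implicit Arguments.
Unset Strict Implicit.
Unset Printing Implicit Defensive.
Import Order.TTheory GRing.Theory Num.Theory.
Local Open Scope classical_set_scope.
Local Open Scope ring_scope.
Local Open Scope card_scope.

(** * Affine hyperplanes as level sets of linear forms *)

Section LevelSets.
Variables (K : fieldType) (E : vectType K) (psi : E -> K) (v : E).
Hypothesis psi_scalar : scalar psi.
Hypothesis psi_v : psi v != 0.

Let psi_linear : {scalar E} :=
  HB.pack psi (GRing.isLinear.Build K E K *%R psi psi_scalar).

Lemma formD x y : psi (x + y) = psi x + psi y.
Proof. exact: (raddfD psi_linear). Qed.

Lemma formB x y : psi (x - y) = psi x - psi y.
Proof. exact: (raddfB psi_linear). Qed.

Lemma formZ a x : psi (a *: x) = a * psi x.
Proof. exact: (linearZ_LR psi_linear). Qed.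

Definition kernel_of_form : {vspace E} := lker (linfun (psi_linear : E -> K^o)).

Lemma mem_kernel x : (x \in kernel_of_form) = (psi x == 0).
Proof. by rewrite memv_ker lfunE. Qed.

Lemma dim_kernel : (\dim kernel_of_form).+1 = \dim {: E}.
Proof.
have := limg_ker_dim (linfun (psi_linear : E -> K^o)) fullv.
rewrite capfv -/kernel_of_form => <-; rewrite -addn1; congr addn.
apply/esym/eqP; rewrite eqn_leq; apply/andP; split.
  by rewrite (leq_trans (dimvS (subvf _)))// dimvf.
rewrite lt0n dimv_eq0; apply: contra psi_v => /eqP h.
have : linfun (psi_linear : E -> K^o) v \in (linfun (psi_linear : E -> K^o) @: fullv)%VS.
  by rewrite memv_img ?memvf.
by rewrite h memv0 lfunE.
Qed.

Lemma level_affine_hyperplane c : affine_hyperplane [set z | psi z = c].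
Proof.
exists ((c / psi v) *: v), kernel_of_form; split; first exact: dim_kernel.
apply/seteqP; split=> z /=; rewrite mem_kernel formB formZ divfK // subr_eq0.
  by move=> ->.
by move/eqP.
Qed.

(** Both sets are parallel to subspaces of the same dimension, so an inclusion
between them is an equality. *)
Lemma affine_hyperplane_level (A : set E) c :
  affine_hyperplane A -> A `<=` [set z | psi z = c] -> A = [set z | psi z = c].
Proof.
move=> [p [H [dimH ->]]] sub.
have pc : psi p = c by apply: sub; rewrite /= subrr mem0v.
have HE : H = kernel_of_form.
  apply/eqP; rewrite eqEdim; apply/andP; split.
    apply/subvP => h hH; rewrite mem_kernel.
    have : psi (h + p) = c by apply: sub; rewrite /= addrK.
    by rewrite formD pc => /eqP; rewrite -subr_eq0 addrK.
  by rewrite -ltnS dimH dim_kernel.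
apply/seteqP; split => // z /= zc.
by rewrite HE mem_kernel formB zc pc subrr.
Qed.

(** One nontrivial affine equation satisfied by the fixed points of a reflection
already cuts out its hyperplane: this spares any study of the linear part. *)
Lemma reflection_fixed_level (f : E -> E) c :
  is_reflection f -> fixed_points f `<=` [set z | psi z = c] ->
  fixed_points f = [set z | psi z = c].
Proof.
move=> [_ _ _ [A hA Af]] sub; apply/seteqP; split=> //.
by rewrite -(affine_hyperplane_level hA (subset_trans Af sub)).
Qed.

(** The symmetry along v with respect to the hyperplane psi = c.  The condition
psi v = 2 makes it send the value psi z to 2 c - psi z, hence an involution. *)
Lemma symmetry_reflection (f : E -> E) c : psi v = 2 ->
    (forall z, f z = z - (psi z - c) *: v) ->
  is_reflection f /\ fixed_points f = [set z | psi z = c].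
Proof.
move=> v2 fE.
have v0 : v != 0.
  apply: contra psi_v => /eqP->; have := formB 0 0; rewrite subrr => ->.
  by rewrite subrr.
have psif z : psi (f z) = 2 * c - psi z by rewrite fE formB formZ v2; ring.
have fixE : fixed_points f = [set z | psi z = c].
  apply/seteqP; split => z /=; rewrite /fixed_points /= fE.
    move/eqP; rewrite -subr_eq0 addrAC subrr add0r oppr_eq0 scaler_eq0 (negPf v0).
    by rewrite orbF subr_eq0 => /eqP.
  by move=> ->; rewrite subrr scale0r subr0.
split=> //; split.
- have glin : linear (fun z => z - psi z *: v).
    move=> a x y; rewrite formD formZ scalerDl scalerBr scalerA opprD.
    by rewrite -!addrA; congr +%R; rewrite addrCA.
  pose g : {linear E -> E} :=
    HB.pack (fun z => z - psi z *: v) (GRing.isLinear.Build K E E *:%R _ glin).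
  exists (linfun g), (c *: v) => z; rewrite fE lfunE /= scalerBl opprB addrA.
  by rewrite addrAC.
(* A point where psi takes the value 1 + c is moved. *)
- move=> fid; have : [set z | psi z = c] (((1 + c) / psi v) *: v).
    by rewrite -fixE /fixed_points /= fid.
  rewrite /= formZ divfK // => /eqP; rewrite -subr_eq0 addrK.
  by rewrite oner_eq0.
- exists 2%N => // z; rewrite /= [f (f z)]fE psif fE -addrA -opprD -scalerDl.
  have -> : psi z - c + (2 * c - psi z - c) = 0 by ring.
  by rewrite scale0r subr0.
- by exists [set z | psi z = c]; [exact: level_affine_hyperplane | rewrite fixE].
Qed.

End LevelSets.

(** * Counting classes by a complete invariant of hyperplanes *)

Section Counting.
Variables (K : fieldType) (E : vectType K) (W : set (E -> E)).

(** P k is the k-th family of sets, I indexing the expected orbits.  W preserves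
each family and is transitive on it, so the class of a reflection is determined
by the family of its fixed-point set. *)
Lemma card_reflection_classes (I : finType) (P : I -> set E -> Prop) :
    (forall s, reflections W s -> exists k, P k (fixed_points s)) ->
    (forall k, exists2 s, reflections W s & P k (fixed_points s)) ->
    (forall k A B, P k A -> P k B -> exists2 w, W w & w @` A = B) ->
    (forall k w A, W w -> P k A -> P k (w @` A)) ->
    (forall k l A, P k A -> P l A -> k = l) ->
  reflection_classes W #= `I_#|I|.
Proof.
move=> cover inhab trans stable disj.
pose F k : set (E -> E) := [set s | reflections W s /\ P k (fixed_points s)].
have classE s k : reflections W s -> P k (fixed_points s) ->
    reflection_class W s = F k.
  move=> Ws Pk; apply/seteqP; split=> s' /= [Ws' h]; split=> //.
    by case: h => w Ww <-; apply: stable.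
  by have [w Ww e] := trans _ _ _ Pk h; exists w.
have -> : reflection_classes W = F @` [set: I].
  apply/seteqP; split=> X /=.
    move=> [s Ws <-]; have [k Pk] := cover s Ws.
    by exists k => //; rewrite (classE s k).
  move=> [k _ <-]; have [s Ws Pk] := inhab k.
  by exists s => //; rewrite (classE s k).
have Finj : {in [set: I] &, injective F}.
  move=> k l _ _ Fkl; have [s Ws Pk] := inhab k.
  have [_ Pl] : F l s by rewrite -Fkl.
  exact: disj Pk Pl.
apply: card_eq_trans (inj_card_eq Finj) _.
have rank_inj : {in [set: I] &, injective (@enum_rank I)}.
  by move=> k l _ _; apply: enum_rank_inj.
rewrite card_eq_sym; apply: card_eq_trans card_II _.
suff -> : [set: 'I_#|I|] = @enum_rank I @` [set: I] by exact: inj_card_eq.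
by apply/seteqP; split=> // i _; exists (enum_val i); rewrite ?enum_valK.
Qed.

End Counting.

(** * The lattice and its quotient by 2 *)

Section Lattice.
Variables (R : realType) (alpha : R[i]).
Local Notation C := R[i].
Local Notation L := (lattice alpha).

Lemma lattice0 : L 0.
Proof. by exists 0, 0; rewrite !mul0r addr0. Qed.

Lemma latticeD x y : L x -> L y -> L (x + y).
Proof.
by move=> [a [b ->]] [c [d ->]]; exists (a + c), (b + d); rewrite !intrD; ring.
Qed.

Lemma latticeN x : L x -> L (- x).
Proof. by move=> [a [b ->]]; exists (- a), (- b); rewrite !intrN; ring. Qed.

Lemma latticeB x y : L x -> L y -> L (x - y).
Proof. by move=> Lx Ly; apply/latticeD/latticeN. Qed.

Lemma lattice_sign (b : bool) x : L x -> L ((-1) ^+ b * x).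
Proof. by case: b => Lx; rewrite ?expr1 ?expr0 ?mulN1r ?mul1r //; apply: latticeN. Qed.

(** The element of L/2L whose coordinates modulo 2 are k.1 and k.2. *)
Definition lattice_coset (k : bool * bool) : set C :=
  [set x | exists2 u, L u & x = k.1%:R + k.2%:R * alpha + 2 * u].

Lemma lattice_coset_sub k x : lattice_coset k x -> L x.
Proof.
move=> [u Lu ->]; apply: latticeD.
  by exists k.1, k.2; rewrite /= -!pmulrn.
by rewrite mulr2n mulrDl mul1r; apply: latticeD.
Qed.

Lemma lattice_coset_repr k : lattice_coset k (k.1%:R + k.2%:R * alpha).
Proof. by exists 0; rewrite ?mulr0 ?addr0 //; apply: lattice0. Qed.

Lemma lattice_coset_double k x u : L u -> lattice_coset k x ->
  lattice_coset k (x + 2 * u).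
Proof.
by move=> Lu [v Lv ->]; exists (v + u); [apply: latticeD | rewrite mulrDr addrA].
Qed.

(** This is why the signs of the groups do not identify elements of L/2L. *)
Lemma lattice_cosetN k x : lattice_coset k x -> lattice_coset k (- x).
Proof.
move=> xk; have -> : - x = x + 2 * (- x) by ring.
by apply: lattice_coset_double => //; apply/latticeN/lattice_coset_sub/xk.
Qed.

Lemma lattice_coset_sign k (b : bool) x :
  lattice_coset k x -> lattice_coset k ((-1) ^+ b * x).
Proof. by case: b => Lx; rewrite ?expr1 ?expr0 ?mulN1r ?mul1r //; apply: lattice_cosetN. Qed.

Lemma lattice_coset_diff k x y : lattice_coset k x -> lattice_coset k y ->
  exists2 u, L u & y = x + 2 * u.
Proof.
move=> [u Lu ->] [v Lv ->]; exists (v - u); first exact: latticeB.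
by ring.
Qed.

Lemma int_parity (a : int) : exists (p : bool) c, a = p%:Z + 2 * c.
Proof.
exists ((a %% 2)%Z == 1), (a %/ 2)%Z.
by case: eqP => h /=; lia.
Qed.

Lemma lattice_coset_cover x : L x -> exists k, lattice_coset k x.
Proof.
move=> [a [b ->]]; have [p [c ->]] := int_parity a.
have [q [d ->]] := int_parity b; exists (p, q), (c%:~R + d%:~R * alpha).
  by exists c, d.
by rewrite !intrD !intrM -!pmulrn /=; ring.
Qed.

Hypothesis im_alpha : 0 < complex.Im alpha.

(** Otherwise alpha would be a quotient of integers, hence real. *)
Lemma lattice_free (a b c d : int) :
  a%:~R + b%:~R * alpha = c%:~R + d%:~R * alpha -> a = c /\ b = d.
Proof.
move=> h; have bd : b = d.
  apply/eqP/negPn/negP => nbd.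
  have alphaE : alpha = (c - a)%:~R / (b - d)%:~R.
    have nz : (b - d)%:~R != 0 :> C by rewrite intr_eq0 subr_eq0.
    apply: (mulIf nz); rewrite divfK // !intrB.
    have -> : alpha * (b%:~R - d%:~R) = a%:~R + b%:~R * alpha - a%:~R - d%:~R * alpha.
      by ring.
    by rewrite h; ring.
  have real_alpha : alpha \is Num.real by rewrite alphaE rpred_div // realz.
  by have /= := RIm_real real_alpha; case => im0; move: im_alpha; rewrite im0 ltxx.
by split=> //; move: h; rewrite bd => /addIr/intr_inj.
Qed.

Lemma lattice_coset_disj k l x : lattice_coset k x -> lattice_coset l x -> k = l.
Proof.
case: k l => [p q] [p' q'] /= [u [a [b ->]] ->] [v [c [d ->]] /= e].
have [] := @lattice_free (p%:Z + 2 * a) (q%:Z + 2 * b) (p'%:Z + 2 * c) (q'%:Z + 2 * d).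
  rewrite !intrD !intrM -!pmulrn.
  transitivity (p%:R + q%:R * alpha + 2 * (a%:~R + b%:~R * alpha)); first by ring.
  by rewrite e; ring.
move=> h1 h2; congr pair.
  by move: h1; case: p p' {e} => -[] //= h1; lia.
by move: h2; case: q q' {e} => -[] //= h2; lia.
Qed.

End Lattice.

(** * Signed permutations *)

Lemma perm_two_points (T : finType) (i j k l : T) : i != j -> k != l ->
  exists p : {perm T}, p k = i /\ p l = j.
Proof.
move=> ij kl; exists (tperm k i * tperm (tperm k i l) j)%g.
split; last by rewrite permM tpermL.
rewrite permM tpermL; apply: tpermD; last by rewrite eq_sym.
by apply: contra kl => /eqP h; rewrite -(inj_eq (@perm_inj _ (tperm k i))) tpermL h.
Qed.

Section SignedPermutations.
Variables (R : realType) (alpha : R[i]).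
Hypothesis im_alpha : 0 < complex.Im alpha.
Local Notation C := R[i].
Local Notation L := (lattice alpha).

Lemma crystG21P n (f : 'cV[C]_n -> 'cV[C]_n) :
  crystG21 alpha n f <->
  exists (e : 'I_n -> bool) (s : 'S_n) (t : 'cV[C]_n), lattice_vec alpha t /\
    forall z i, f z i 0 = (-1) ^+ e i * z (s i) 0 + t i 0.
Proof.
have coordE (e : 'I_n -> bool) (s : 'S_n) (t z : 'cV[C]_n) i :
    (diag_mx (\row_i (-1) ^+ e i) *m perm_mx s *m z + t) i 0 =
    (-1) ^+ e i * z (s i) 0 + t i 0.
  by rewrite -mulmxA -row_permE mul_diag_mx !mxE.
split=> [[g [t [[e [s ->]] Lt fE]]] | [e [s [t [Lt fE]]]]].
  by exists e, s, t; split=> // z i; rewrite fE coordE.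
exists (diag_mx (\row_i (-1) ^+ e i) *m perm_mx s), t; split=> //.
  by exists e, s.
by move=> z; apply/matrixP => i j; rewrite ord1 coordE fE.
Qed.

(** Surjectivity is what turns images into inverse images: if A is the inverse
image of B under a surjective w, then w maps A onto B.  Inverse images of level
sets are computed by substituting the coordinates of w in the equation. *)
Lemma crystG21_surj n (w : 'cV[C]_n -> 'cV[C]_n) :
  crystG21 alpha n w -> range w = [set: 'cV[C]_n].
Proof.
move=> /crystG21P[e [s [t [_ wE]]]]; apply/seteqP; split=> // y _.
exists (\col_i ((-1) ^+ e (s^-1%g i) * (y (s^-1%g i) 0 - t (s^-1%g i) 0))) => //.
apply/matrixP => i j; rewrite ord1 wE mxE permK.
by rewrite mulrA -expr2 sqrr_sign mul1r subrK.
Qed.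

(** The factor 2 makes the constant range over L, with invariant in L/2L. *)
Definition coord_hyperplane n (k : bool * bool) (A : set 'cV[C]_n) : Prop :=
  exists (i : 'I_n) c, lattice_coset alpha k c /\ A = [set z | 2 * z i 0 = c].

Definition diag_hyperplane n (A : set 'cV[C]_n) : Prop :=
  exists (i j : 'I_n) (b : bool) t,
    [/\ i != j, L t & A = [set z | z i 0 - (-1) ^+ b * z j 0 = t]].

Lemma coord_scalar n (i : 'I_n) : scalar (fun z : 'cV[C]_n => 2 * z i 0).
Proof. by move=> a x y; rewrite !mxE; ring. Qed.

Lemma diag_scalar n (i j : 'I_n) (b : bool) :
  scalar (fun z : 'cV[C]_n => z i 0 - (-1) ^+ b * z j 0).
Proof. by move=> a x y; rewrite !mxE; ring. Qed.

Lemma two_neq0 : (2 : C) != 0.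
Proof. by rewrite pnatr_eq0. Qed.

Lemma coord_form_delta n (i : 'I_n) : 2 * (delta_mx i 0 : 'cV[C]_n) i 0 = 2.
Proof. by rewrite mxE !eqxx mulr1. Qed.

Lemma diag_form_delta n (i j : 'I_n) (b : bool) : i != j ->
  (delta_mx i 0 : 'cV[C]_n) i 0 - (-1) ^+ b * (delta_mx i 0 : 'cV[C]_n) j 0 = 1.
Proof.
by move=> ij; rewrite !mxE !eqxx (eq_sym j) (negPf ij) mulr0 subr0.
Qed.

(** Some coordinate i is moved by the reflection, and its equation
z_i = e_i z_(p i) + t_i, which holds on the fixed points, is then nontrivial:
the case p i = i with sign +1 would force t_i = 0, as fixed points exist. *)
Lemma crystG21_fixed n s : reflections (crystG21 alpha n) s ->
  (exists k, coord_hyperplane k (fixed_points s)) \/ diag_hyperplane (fixed_points s).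
Proof.
move=> [/crystG21P[e [p [t [Lt sE]]]] sR].
have [_ sid _ [A [q [H [_ Aq]]] As]] := sR.
have sq : s q = q by apply: As; rewrite Aq /= subrr mem0v.
have fixE i z : fixed_points s z -> z i 0 = (-1) ^+ e i * z (p i) 0 + t i 0.
  by move=> /= sz; rewrite -sE sz.
have [i [z zi]] : exists i z, s z i 0 != z i 0.
  apply: contrapT => h; apply: sid; apply/funext => z.
  apply/matrixP => i j; rewrite ord1; apply/eqP/negPn/negP => zi.
  by apply: h; exists i, z.
have [pi|pi] := eqVneq (p i) i.
  case ei : (e i); last first.
    have := fixE i q sq; rewrite pi ei mul1r => /eqP.
    rewrite -subr_eq0 opprD addrA subrr add0r oppr_eq0 => /eqP t0.
    by move: zi; rewrite sE pi ei mul1r t0 addr0 eqxx.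
  left; have [k tk] := lattice_coset_cover (Lt i); exists k, i, (t i 0).
  split=> //; apply: (reflection_fixed_level (v := delta_mx i 0) (coord_scalar i)) sR _.
    by rewrite (coord_form_delta i) two_neq0.
  by move=> y /(fixE i); rewrite pi ei expr1 /= => yi; rewrite {1}mulr2n mulrDl {1}yi; ring.
right; exists i, (p i), (e i), (t i 0); split=> //; first by rewrite eq_sym.
apply: (reflection_fixed_level (v := delta_mx i 0) (diag_scalar i (p i) (e i))) sR _.
  by rewrite diag_form_delta ?oner_eq0 // eq_sym.
by move=> y /(fixE i) /= {1}->; rewrite addrC addKr.
Qed.

Lemma coord_reflection n k (i : 'I_n) :
  exists2 s, reflections (crystG21 alpha n) s & coord_hyperplane k (fixed_points s).
Proof.
pose c : C := k.1%:R + k.2%:R * alpha.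
have ck : lattice_coset alpha k c := lattice_coset_repr alpha k.
pose s (z : 'cV[C]_n) := z - (2 * z i 0 - c) *: delta_mx i 0.
have [||sR fixE] := symmetry_reflection (coord_scalar i) _ _ (fun z => erefl (s z)).
- by rewrite coord_form_delta two_neq0.
- exact: coord_form_delta.
exists s; last by exists i, c.
split=> //; apply/crystG21P.
exists (fun j => j == i), 1%g, (c *: delta_mx i 0); split.
  move=> j; rewrite !mxE andbT; case: eqP => _.
    by rewrite mulr1; exact: lattice_coset_sub ck.
  by rewrite mulr0; exact: lattice0.
move=> z j; rewrite perm1 !mxE andbT; case: eqP => [->|_] /=; last by ring.
by rewrite expr1; ring.
Qed.

Lemma diag_reflection n (i j : 'I_n) : i != j ->
  exists2 s, reflections (crystG21 alpha n) s & diag_hyperplane (fixed_points s).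
Proof.
move=> ij; pose v : 'cV[C]_n := delta_mx i 0 - delta_mx j 0.
pose s (z : 'cV[C]_n) := z - (z i 0 - (-1) ^+ false * z j 0 - 0) *: v.
have v2 : v i 0 - (-1) ^+ false * v j 0 = 2.
  by rewrite !mxE !eqxx (eq_sym j) (negPf ij) /=; ring.
have [|sR fixE] := symmetry_reflection (diag_scalar i j false) _ v2 (fun z => erefl (s z)).
  by rewrite v2 two_neq0.
exists s; last by exists i, j, false, 0; split=> //; apply: lattice0.
split=> //; apply/crystG21P.
exists (fun=> false), (tperm i j), 0; split.
  by move=> k; rewrite mxE; exact: lattice0.
move=> z k; rewrite !mxE !andbT.
case: tpermP => [->|->|/eqP/negPf-> /eqP/negPf->].
- by rewrite eqxx (negPf ij) /=; ring.
- by rewrite eqxx eq_sym (negPf ij) /=; ring.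
by rewrite /=; ring.
Qed.

(** The transposition of the two coordinates followed by a diagonal translation. *)
Lemma coord_trans n k (A B : set 'cV[C]_n) :
  coord_hyperplane k A -> coord_hyperplane k B ->
  exists2 w, crystG21 alpha n w & w @` A = B.
Proof.
move=> [i [c [ck ->]]] [j [d [dk ->]]].
have [u Lu dE] := lattice_coset_diff ck dk.
pose w (z : 'cV[C]_n) : 'cV[C]_n := \col_l (z (tperm i j l) 0 + u).
have Ww : crystG21 alpha n w.
  apply/crystG21P; exists (fun=> false), (tperm i j), (const_mx u); split.
    by move=> l; rewrite mxE.
  by move=> z l; rewrite !mxE mul1r.
exists w => //; rewrite -[RHS](image_preimage _ (crystG21_surj Ww)); congr image.
apply/seteqP; split=> z /=; rewrite mxE tpermR mulrDr dE.
  by move=> ->.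
by move/addIr.
Qed.

(** The permutation places the coordinates, a sign change on the second one
adjusts b into b', and a translation of the first one adjusts the constant. *)
Lemma diag_trans n (A B : set 'cV[C]_n) :
  diag_hyperplane A -> diag_hyperplane B ->
  exists2 w, crystG21 alpha n w & w @` A = B.
Proof.
move=> [i [j [b [t [ij Lt ->]]]]] [k [l [b' [t' [kl Lt' ->]]]]].
have [p [pk pl]] := perm_two_points ij kl.
pose w (z : 'cV[C]_n) : 'cV[C]_n :=
  \col_m ((-1) ^+ ((m == l) && (b (+) b')) * z (p m) 0 + (m == k)%:R * (t' - t)).
have Ww : crystG21 alpha n w.
  apply/crystG21P.
  exists (fun m => (m == l) && (b (+) b')), p, (\col_m ((m == k)%:R * (t' - t))).
  split; last by move=> z m; rewrite !mxE.
  move=> m; rewrite mxE; case: eqP => _; rewrite ?mul1r ?mul0r.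
    exact: latticeB.
  exact: lattice0.
have wE z : w z k 0 - (-1) ^+ b' * w z l 0 =
    z i 0 - (-1) ^+ b * z j 0 + (t' - t).
  rewrite !mxE pk pl !eqxx (negPf kl) (eq_sym l) (negPf kl) /=.
  by case: (b); case: (b') => /=; ring.
exists w => //; rewrite -[RHS](image_preimage _ (crystG21_surj Ww)); congr image.
apply/seteqP; split=> z /=; rewrite wE.
  by move=> ->; rewrite addrCA subrr addr0.
by rewrite -[X in _ = X](subrKC t) => /addIr.
Qed.

Lemma coord_stable n k w (A : set 'cV[C]_n) :
  crystG21 alpha n w -> coord_hyperplane k A -> coord_hyperplane k (w @` A).
Proof.
move=> Ww [i [c [ck ->]]]; have surj := crystG21_surj Ww.
have /crystG21P[e [s [t [Lt wE]]]] := Ww.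
pose j := (s^-1)%g i.
exists j, ((-1) ^+ e j * c + 2 * t j 0); split.
  exact: lattice_coset_double (Lt j) (lattice_coset_sign _ ck).
rewrite -[RHS](image_preimage _ surj); congr image.
apply/seteqP; split=> z /=; rewrite wE permKV mulrDr mulrCA.
  by move=> ->.
by move/addIr/(can_inj (signrMK _)).
Qed.

Lemma diag_stable n w (A : set 'cV[C]_n) :
  crystG21 alpha n w -> diag_hyperplane A -> diag_hyperplane (w @` A).
Proof.
move=> Ww [i [j [b [c [ij Lc ->]]]]]; have surj := crystG21_surj Ww.
have /crystG21P[e [s [t [Lt wE]]]] := Ww.
pose k := (s^-1)%g i; pose l := (s^-1)%g j; pose b' := e k (+) b (+) e l.
exists k, l, b', ((-1) ^+ e k * c + (t k 0 - (-1) ^+ b' * t l 0)); split.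
- by rewrite (inj_eq perm_inj).
- by apply: latticeD; [exact: lattice_sign | apply: latticeB => //; exact: lattice_sign].
rewrite -[RHS](image_preimage _ surj); congr image.
have -> : w @^-1` [set z | z k 0 - (-1) ^+ b' * z l 0 =
      (-1) ^+ e k * c + (t k 0 - (-1) ^+ b' * t l 0)] =
    [set z | (-1) ^+ e k * (z i 0 - (-1) ^+ b * z j 0) = (-1) ^+ e k * c].
  have wkl z : w z k 0 - (-1) ^+ b' * w z l 0 =
    (-1) ^+ e k * (z i 0 - (-1) ^+ b * z j 0) + (t k 0 - (-1) ^+ b' * t l 0).
    rewrite !wE !permKV /b' !signr_addb.
    have sq : (-1) ^+ e l * (-1) ^+ e l = 1 :> C by rewrite -expr2 sqrr_sign.
    rewrite mulrDr !mulrA -(mulrA _ _ ((-1) ^+ e l)) sq mulr1.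
    by ring.
  by apply/seteqP; split=> z /=; rewrite wkl; [move/addIr | move=> ->].
by apply/seteqP; split=> z /=; [move=> -> | move/(can_inj (signrMK _))].
Qed.

(** Equal hyperplanes have equal constants: evaluate both equations at the
constant vector c / 2, which lies on the first one. *)
Lemma coord_disj n k l (A : set 'cV[C]_n) :
  coord_hyperplane k A -> coord_hyperplane l A -> k = l.
Proof.
move=> [i [c [ck ->]]] [j [d [dl e]]].
have ej (z : 'cV[C]_n) : 2 * z i 0 = c -> 2 * z j 0 = d.
  by move=> h; have : [set z : 'cV[C]_n | 2 * z i 0 = c] z by []; rewrite e.
have cj := ej (const_mx (c / 2)); rewrite !mxE mulrC divfK ?two_neq0 // in cj.
by rewrite -cj // in dl; exact: (lattice_coset_disj im_alpha ck dl).
Qed.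

(** The hyperplane 2 z_l = c is invariant under translation along every basis
vector except the l-th; z_i - e z_j = t is not invariant along the i-th nor
along the j-th, and one of these two is different from l. *)
Lemma coord_diag_disj n k (A : set 'cV[C]_n) :
  coord_hyperplane k A -> diag_hyperplane A -> False.
Proof.
move=> [l [c [_ ->]]] [i [j [b [t [ij _ e]]]]].
have dg (z : 'cV[C]_n) : 2 * z l 0 = c -> z i 0 - (-1) ^+ b * z j 0 = t.
  by move=> h; have : [set z : 'cV[C]_n | 2 * z l 0 = c] z by []; rewrite e.
have shift (m : 'I_n) : m != l ->
    (delta_mx m 0 : 'cV[C]_n) i 0 - (-1) ^+ b * (delta_mx m 0 : 'cV[C]_n) j 0 = 0.
  move=> ml; have z0 : 2 * (const_mx (c / 2) : 'cV[C]_n) l 0 = c.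
    by rewrite mxE mulrC divfK ?two_neq0.
  have := dg (const_mx (c / 2) + delta_mx m 0); have := dg _ z0.
  rewrite !mxE (eq_sym l) (negPf ml) /= addr0 => h0 h1.
  have := h1 _; rewrite mulrC divfK ?two_neq0 // => /(_ erefl) h2.
  by rewrite -(subrr t) -{1}h2 -h0; ring.
have [il|il] := eqVneq i l.
  have := shift j; rewrite -il eq_sym => /(_ ij)/eqP.
  by rewrite !mxE !eqxx (negPf ij) /= sub0r mulr1 oppr_eq0 signr_eq0.
have := shift i il; rewrite diag_form_delta // => /eqP; rewrite oner_eq0.
by [].
Qed.

Lemma card_crystG21_1 : reflection_classes (crystG21 alpha 1) #= `I_4.
Proof.
have -> : `I_4 = `I_#|{: bool * bool}| by rewrite card_prod card_bool.
apply: (card_reflection_classes (P := @coord_hyperplane 1)).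
- move=> s /crystG21_fixed[//|[i [j [b [t [ij]]]]]].
  by rewrite !ord1 eqxx in ij.
- by move=> k; exact: (coord_reflection k 0).
- exact: coord_trans.
- by move=> k w A; exact: coord_stable.
- by move=> k l A; exact: coord_disj.
Qed.

Lemma card_crystG21 n : (2 <= n)%N -> reflection_classes (crystG21 alpha n) #= `I_5.
Proof.
move=> n2; have i0 := Ordinal (ltnW n2); pose i1 := Ordinal n2.
have -> : `I_5 = `I_#|{: option (bool * bool)}|.
  by rewrite card_option card_prod card_bool.
pose P (o : option (bool * bool)) (A : set 'cV[C]_n) :=
  if o is Some k then coord_hyperplane k A else diag_hyperplane A.
apply: (card_reflection_classes (P := P)).
- move=> s /crystG21_fixed[[k sk]|sd]; first by exists (Some k).
  by exists None.
- case=> [k|]; first exact: (coord_reflection k i1).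
  exact: (diag_reflection (i := Ordinal (ltnW n2)) (j := i1)).
- by case=> [k|] A B; [exact: coord_trans | exact: diag_trans].
- by case=> [k|] w A; [exact: coord_stable | exact: diag_stable].
- case=> [k|] [l|] A //= hA hA'.
  + by rewrite (coord_disj hA hA').
  + by case: (coord_diag_disj hA hA').
  + by case: (coord_diag_disj hA' hA).
Qed.

End SignedPermutations.

(** * Permutations acting on the vectors of sum zero *)

Section Permutations.
Variables (R : realType) (alpha : R[i]).
Local Notation C := R[i].
Local Notation L := (lattice alpha).
Local Notation V n := (subvs_of (sum0_space R n.+1)).

Lemma vsval_inj_coord n (x y : V n) :
  (forall i, vsval x i 0 = vsval y i 0) -> x = y.
Proof.
by move=> h; apply/val_inj/matrixP => i j; rewrite ord1; exact: h.
Qed.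

Definition of_coord n (x : 'cV[C]_n.+1) : V n := vsproj (sum0_space R n.+1) x.

Lemma of_coordK n (x : 'cV[C]_n.+1) : \sum_i x i 0 = 0 -> vsval (of_coord x) = x.
Proof. by move=> x0; rewrite vsprojK // mem_sum0_space x0. Qed.

Lemma sum_vsval n (z : V n) : \sum_i vsval z i 0 = 0.
Proof. by apply/eqP; rewrite -mem_sum0_space; exact: subvsP. Qed.

Lemma crystAP n (f : V n -> V n) :
  crystA alpha n f <->
  exists (s : 'S_n.+1) (t : 'cV[C]_n.+1),
    [/\ \sum_i t i 0 = 0, lattice_vec alpha t &
        forall z i, vsval (f z) i 0 = vsval z (s i) 0 + t i 0].
Proof.
split=> [[s [t [t0 Lt fE]]] | [s [t [t0 Lt fE]]]]; exists s, t; split=> //.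
- by apply/eqP; rewrite -mem_sum0_space.
- by move=> z i; rewrite fE -row_permE !mxE.
- by rewrite mem_sum0_space t0.
- by move=> z; apply/matrixP => i j; rewrite ord1 fE -row_permE !mxE.
Qed.

Lemma crystA_intro n (s : 'S_n.+1) (t : 'cV[C]_n.+1) :
    \sum_i t i 0 = 0 -> lattice_vec alpha t ->
  exists2 w, crystA alpha n w &
    forall z i, vsval (w z) i 0 = vsval z (s i) 0 + t i 0.
Proof.
move=> t0 Lt; pose w (z : V n) : V n := of_coord (\col_i (vsval z (s i) 0 + t i 0)).
have wE z i : vsval (w z) i 0 = vsval z (s i) 0 + t i 0.
  rewrite of_coordK ?mxE //.
  under eq_bigr do rewrite mxE.
  rewrite big_split /= t0 addr0 -[RHS](sum_vsval z).
  by rewrite [RHS](reindex_inj (@perm_inj _ s)).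
by exists w => //; apply/crystAP; exists s, t.
Qed.

Lemma crystA_surj n (w : V n -> V n) : crystA alpha n w -> range w = [set: V n].
Proof.
move=> /crystAP[s [t [t0 _ wE]]]; apply/seteqP; split=> // y _.
exists (of_coord (\col_i (vsval y (s^-1%g i) 0 - t (s^-1%g i) 0))) => //.
apply: vsval_inj_coord => i; rewrite wE of_coordK ?mxE ?permK ?subrK //.
under eq_bigr do rewrite mxE.
rewrite -(reindex_inj (@perm_inj _ s^-1%g) (P := xpredT) (F := fun i => vsval y i 0 - t i 0)) /=.
by rewrite sumrB sum_vsval t0 subrr.
Qed.

Definition root_form n (i j : 'I_n.+1) (z : V n) : C := vsval z i 0 - vsval z j 0.

Lemma root_scalar n (i j : 'I_n.+1) : scalar (@root_form n i j).
Proof. by move=> a x y; rewrite /root_form linearP !mxE; ring. Qed.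

Lemma sum_delta n (i : 'I_n.+1) : \sum_k (delta_mx i 0 : 'cV[C]_n.+1) k 0 = 1.
Proof.
rewrite (bigD1 i) //= big1 => [|k /negPf ki]; rewrite mxE ?eqxx ?addr0 //.
by rewrite ki.
Qed.

Lemma sum_root_vector n (i j : 'I_n.+1) (a : C) :
  \sum_k (a *: (delta_mx i 0 - delta_mx j 0 : 'cV[C]_n.+1)) k 0 = 0.
Proof.
under eq_bigr do rewrite mxE [X in _ * X]mxE [X in _ * (_ + X)]mxE.
by rewrite -mulr_sumr sumrB !sum_delta subrr mulr0.
Qed.

Lemma lattice_root_vector n (i j : 'I_n.+1) (a : C) : L a ->
  lattice_vec alpha (a *: (delta_mx i 0 - delta_mx j 0)).
Proof.
move=> La k; rewrite !mxE !andbT mulrBr; apply: latticeB;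
  by case: eqP => _; rewrite ?mulr1 ?mulr0 //; apply: lattice0.
Qed.

Definition root_vector n (i j : 'I_n.+1) : V n :=
  of_coord (delta_mx i 0 - delta_mx j 0).

Lemma root_vectorE n (i j k : 'I_n.+1) :
  vsval (root_vector i j) k 0 = (k == i)%:R - (k == j)%:R.
Proof.
rewrite of_coordK ?mxE ?andbT //.
by have := sum_root_vector i j 1; rewrite scale1r.
Qed.

Lemma root_form_vector n (i j : 'I_n.+1) : i != j ->
  root_form i j (root_vector i j) = 2.
Proof.
move=> ij; rewrite /root_form !root_vectorE !eqxx (eq_sym j) (negPf ij) /=.
by ring.
Qed.

Lemma root_form_neq0 n (i j : 'I_n.+1) : i != j ->
  root_form i j (root_vector i j) != 0.
Proof. by move=> /root_form_vector->; rewrite two_neq0. Qed.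

(** The orbits are obtained when D is a coset, in the lattice, of the group of the
differences t_i - t_j of translations t: the whole lattice in rank at least two,
a class modulo 2L in rank one. *)
Definition root_hyperplane n (D : set C) (A : set (V n)) : Prop :=
  exists (i j : 'I_n.+1) t, [/\ i != j, D t & A = [set z | root_form i j z = t]].

(** Some coordinate i is moved; p i = i is excluded, since the equation of a
fixed point would give t_i = 0. *)
Lemma crystA_fixed n s : reflections (crystA alpha n) s ->
  root_hyperplane L (fixed_points s).
Proof.
move=> [/crystAP[p [t [t0 Lt sE]]] sR].
have [_ sid _ [A [q [H [_ Aq]]] As]] := sR.
have sq : s q = q by apply: As; rewrite Aq /= subrr mem0v.
have fixE i z : fixed_points s z -> vsval z i 0 = vsval z (p i) 0 + t i 0.
  by move=> /= sz; rewrite -sE sz.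
have [i [z zi]] : exists i z, vsval (s z) i 0 != vsval z i 0.
  apply: contrapT => h; apply: sid; apply/funext => z.
  apply: vsval_inj_coord => i; apply/eqP/negPn/negP => zi.
  by apply: h; exists i, z.
have pi : i != p i.
  apply/eqP => pi; have := fixE i q sq; rewrite -pi => /eqP.
  rewrite -subr_eq0 opprD addrA subrr add0r oppr_eq0 => /eqP ti0.
  by move: zi; rewrite sE -pi ti0 addr0 eqxx.
exists i, (p i), (t i 0); split=> //.
apply: (reflection_fixed_level (root_scalar i (p i)) (root_form_neq0 pi)) sR _.
by move=> y /(fixE i); rewrite /= /root_form => ->; rewrite addrC addKr.
Qed.

Lemma root_reflection n (i j : 'I_n.+1) (D : set C) t : i != j -> D t -> L t ->
  exists2 s, reflections (crystA alpha n) s & root_hyperplane D (fixed_points s).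
Proof.
move=> ij Dt Lt.
pose s (z : V n) := z - (root_form i j z - t) *: root_vector i j.
have [sR fixE] := symmetry_reflection (root_scalar i j) (root_form_neq0 ij)
  (root_form_vector ij) (fun z => erefl (s z)).
exists s; last by exists i, j, t.
split=> //; apply/crystAP.
exists (tperm i j), (t *: (delta_mx i 0 - delta_mx j 0)); split.
- exact: sum_root_vector.
- exact: lattice_root_vector.
move=> z k; rewrite raddfB linearZ /= !mxE root_vectorE !andbT /root_form.
case: tpermP => [->|->|/eqP/negPf-> /eqP/negPf->].
- by rewrite eqxx (negPf ij) /=; ring.
- by rewrite eqxx eq_sym (negPf ij) /=; ring.
by rewrite /=; ring.
Qed.

Lemma root_trans n (D : set C) (A B : set (V n)) :
    (forall i j t t', i != j -> D t -> D t' ->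
      exists u : 'cV[C]_n.+1, [/\ \sum_k u k 0 = 0, lattice_vec alpha u &
        t' = t + (u i 0 - u j 0)]) ->
  root_hyperplane D A -> root_hyperplane D B ->
  exists2 w, crystA alpha n w & w @` A = B.
Proof.
move=> shift [i [j [t [ij Dt ->]]]] [k [l [t' [kl Dt' ->]]]].
have [u [u0 Lu t'E]] := shift _ _ _ _ kl Dt Dt'.
have [p [pk pl]] := perm_two_points ij kl.
have [w Ww wE] := crystA_intro p u0 Lu.
exists w => //; rewrite -[RHS](image_preimage _ (crystA_surj Ww)); congr image.
have wkl z : root_form k l (w z) = root_form i j z + (u k 0 - u l 0).
  by rewrite /root_form !wE pk pl; ring.
by apply/seteqP; split=> z /=; rewrite wkl t'E; [move=> -> | move/addIr].
Qed.

Lemma root_stable n (D : set C) w (A : set (V n)) :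
    (forall i j t (u : 'cV[C]_n.+1), i != j -> D t -> \sum_k u k 0 = 0 ->
      lattice_vec alpha u -> D (t + (u i 0 - u j 0))) ->
  crystA alpha n w -> root_hyperplane D A -> root_hyperplane D (w @` A).
Proof.
move=> shift Ww [i [j [t [ij Dt ->]]]]; have surj := crystA_surj Ww.
have /crystAP[p [u [u0 Lu wE]]] := Ww.
pose k := (p^-1)%g i; pose l := (p^-1)%g j.
have kl : k != l by rewrite (inj_eq perm_inj).
exists k, l, (t + (u k 0 - u l 0)); split=> //; first exact: shift.
rewrite -[RHS](image_preimage _ surj); congr image.
have wkl z : root_form k l (w z) = root_form i j z + (u k 0 - u l 0).
  by rewrite /root_form !wE !permKV; ring.
by apply/seteqP; split=> z /=; rewrite wkl; [move=> -> | move/addIr].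
Qed.

(** A third coordinate k exists, and the translation along e_i - e_k changes
z_i - z_j by an arbitrary element of the lattice. *)
Lemma card_crystA n : (2 <= n)%N -> reflection_classes (crystA alpha n) #= `I_1.
Proof.
move=> n2; have -> : `I_1 = `I_#|{: unit}| by rewrite card_unit.
apply: (card_reflection_classes (P := fun _ : unit => @root_hyperplane n L)).
- by move=> s sR; exists tt; exact: crystA_fixed.
- move=> _; apply: (root_reflection (i := ord0) (j := ord_max)) (lattice0 _) (lattice0 _).
  by rewrite -val_eqE /= eq_sym -lt0n ltnW.
- move=> _ A B; apply: root_trans => i j t t' ij Lt Lt'.
  have [k /andP[ki kj]] : exists k : 'I_n.+1, (k != i) && (k != j).
    have /subsetPn[k _ kij] : ~~ ([set: 'I_n.+1]%SET \subset [set i; j]%SET).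
      apply/negP => /subset_leq_card.
      by rewrite cardsT card_ord cards2 ij leqNgt ltnS n2.
    by exists k; move: kij; rewrite !inE negb_or.
  exists ((t' - t) *: (delta_mx i 0 - delta_mx k 0)); split.
  + exact: sum_root_vector.
  + by apply/lattice_root_vector/latticeB.
  rewrite !mxE !eqxx (eq_sym j) (eq_sym i k) (negPf ij) (eq_sym j).
  by rewrite (negPf ki) (negPf kj) /=; ring.
- move=> _ w A; apply: root_stable => i j t u _ Lt _ Lu.
  by apply: latticeD => //; apply: latticeB.
- by move=> [] [].
Qed.

End Permutations.

(** * The rank one case *)

Section RankOne.
Variables (R : realType) (alpha : R[i]).
Hypothesis im_alpha : 0 < complex.Im alpha.
Local Notation C := R[i].
Local Notation L := (lattice alpha).
Local Notation V := (subvs_of (sum0_space R 2)).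

Lemma ord2_eq (i j k : 'I_2) : i != j -> k = i \/ k = j.
Proof.
by case: i j k => [[|[|//]] ?] [[|[|//]] ?] [[|[|//]] ?] // _;
  by [left; apply: val_inj | right; apply: val_inj].
Qed.

Lemma sum_ord2 (x : 'cV[C]_2) i j : i != j -> \sum_k x k 0 = x i 0 + x j 0.
Proof.
move=> ij; rewrite (bigD1 i) //= (bigD1 j) 1?eq_sym //= big1 ?addr0 //.
by move=> k /andP[ki kj]; case: (ord2_eq k ij) ki kj => ->; rewrite eqxx.
Qed.

(** Translations have opposite coordinates, so z_i - z_j is shifted by elements
of 2L only. *)
Lemma card_crystA_1 : reflection_classes (crystA alpha 1) #= `I_4.
Proof.
have -> : `I_4 = `I_#|{: bool * bool}| by rewrite card_prod card_bool.
apply: (card_reflection_classes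
  (P := fun k => @root_hyperplane R 1 (lattice_coset alpha k))).
- move=> s /crystA_fixed[i [j [t [ij Lt sE]]]].
  by have [k tk] := lattice_coset_cover Lt; exists k, i, j, t.
- move=> k; have tk := lattice_coset_repr alpha k.
  exact: (root_reflection (i := ord0) (j := ord_max)) tk (lattice_coset_sub tk).
- move=> k A B; apply: root_trans => i j t t' ij tk t'k.
  have [u Lu ->] := lattice_coset_diff tk t'k.
  exists (u *: (delta_mx i 0 - delta_mx j 0)); split.
  + exact: sum_root_vector.
  + exact: lattice_root_vector.
  by rewrite !mxE !eqxx (eq_sym j) (negPf ij) /=; ring.
- move=> k w A; apply: root_stable => i j t u ij tk u0 Lu.
  have /eqP := sum_ord2 u ij; rewrite u0 eq_sym addr_eq0 => /eqP ui.
  have -> : u i 0 - u j 0 = 2 * u i 0 by rewrite -[u j 0]opprK -ui; ring.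
  exact: lattice_coset_double.
- move=> k l A [i [j [t [ij tk ->]]]] [i' [j' [t' [ij' tl e]]]].
  (* A common point of both hyperplanes compares their constants. *)
  pose z := (t / 2) *: root_vector R i j.
  have zt : root_form i j z = t.
    by rewrite /z (formZ (@root_scalar R 1 i j)) root_form_vector // divfK // two_neq0.
  have zt' : root_form i' j' z = t'.
    by have : [set z | root_form i j z = t] z by []; rewrite e.
  case: (ord2_eq i' ij) => ii; subst i'.
    have jj : j' = j by case: (ord2_eq j' ij) ij' => // ->; rewrite eqxx.
    subst j'; rewrite -zt' zt in tl; exact: (lattice_coset_disj im_alpha tk tl).
  have jj : j' = i by case: (ord2_eq j' ij) ij' => // ->; rewrite eqxx.
  subst j'; apply: (lattice_coset_disj im_alpha tk).
  by have := lattice_cosetN tl; rewrite -zt' /root_form opprB -/(root_form i j z) zt.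
Qed.

Definition antidiag : 'M[C]_(2, 1) := \col_i (-1) ^+ i.

Definition to_sum0 (z : 'cV[C]_1) : V := of_coord (antidiag *m z).
Definition from_sum0 (v : V) : 'cV[C]_1 := const_mx (vsval v 0 0).

Lemma vsval1 (v : V) i : vsval v i 0 = (-1) ^+ i * vsval v 0 0.
Proof.
have /eqP := sum_ord2 (vsval v) (isT : (0 : 'I_2) != 1).
rewrite sum_vsval eq_sym addrC addr_eq0 => /eqP v1.
have [->|->] := @ord2_eq 0 1 i isT; first by rewrite mul1r.
by rewrite v1 expr1 mulN1r.
Qed.

Lemma to_sum0E z i : vsval (to_sum0 z) i 0 = (-1) ^+ i * z 0 0.
Proof.
rewrite of_coordK ?mxE ?big_ord1 ?mxE //.
rewrite (@sum_ord2 _ 0 1) // !mxE !big_ord1 !mxE.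
by rewrite expr0 expr1 mulN1r mul1r subrr.
Qed.

Lemma to_sum0K : cancel to_sum0 from_sum0.
Proof.
by move=> z; apply/matrixP => i j; rewrite !ord1 mxE to_sum0E mul1r.
Qed.

Lemma from_sum0K : cancel from_sum0 to_sum0.
Proof.
by move=> v; apply: vsval_inj_coord => i; rewrite to_sum0E mxE [RHS]vsval1.
Qed.

(** On the line of vectors (x, -x), the transposition acts as x |-> -x. *)
Lemma crystG21_to_crystA f :
  crystG21 alpha 1 f -> crystA alpha 1 (to_sum0 \o f \o from_sum0).
Proof.
move=> /crystG21P[e [s [t [Lt fE]]]]; apply/crystAP.
exists (if e 0 then tperm 0 1 else 1%g), (antidiag *m t); split.
- rewrite (@sum_ord2 _ 0 1) // !mxE !big_ord1 !mxE.
  by rewrite expr0 expr1 mulN1r mul1r subrr.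
- move=> i; rewrite mxE big_ord1 mxE -signr_odd.
  exact: lattice_sign.
move=> v i; rewrite to_sum0E fE !mxE big_ord1 mxE [in RHS]vsval1 mulrDr.
congr (_ + _); rewrite mulrA; congr (_ * _).
case: (e 0); last by rewrite perm1 mulr1.
have [->|->] := @ord2_eq 0 1 i isT; rewrite ?tpermL ?tpermR; rewrite /= ?expr0 ?expr1.
  by rewrite mul1r.
by rewrite mulrNN mulr1.
Qed.

Lemma crystA_to_crystG21 F :
  crystA alpha 1 F -> crystG21 alpha 1 (from_sum0 \o F \o to_sum0).
Proof.
move=> /crystAP[s [t [_ Lt FE]]]; apply/crystG21P.
exists (fun=> odd (s 0)), 1%g, (const_mx (t 0 0)); split.
  by move=> i; rewrite mxE.
by move=> z i; rewrite !mxE FE to_sum0E !ord1 signr_odd.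
Qed.

Lemma to_sum0_affine : is_affine to_sum0.
Proof.
exists (linfun (vsproj (sum0_space R 2) \o mulmx antidiag)), 0 => z.
by rewrite addr0 lfunE.
Qed.

Lemma crystG21_crystA_iso : affine_group_iso (crystG21 alpha 1) (crystA alpha 1).
Proof.
exists (fun f => to_sum0 \o f \o from_sum0), to_sum0; split.
- split.
  + by move=> f /crystG21_to_crystA.
  + move=> f g _ _ /= e; apply/funext => z.
    apply: (can_inj to_sum0K); rewrite -[z]to_sum0K.
    exact: (congr1 (@^~ (to_sum0 z)) e).
  + move=> F WF; exists (from_sum0 \o F \o to_sum0); first exact: crystA_to_crystG21.
    by apply/funext => v /=; rewrite !from_sum0K.
- by move=> g h _ _; apply/funext => v /=; rewrite to_sum0K.
- exact: to_sum0_affine.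
- exact: Bijective to_sum0K from_sum0K.
- by move=> g _; apply/funext => z /=; rewrite to_sum0K.
Qed.

End RankOne.

(** * The classification *)

Unset Implicit Arguments.

Theorem proposition2p4 (R : realType) (alpha : R[i])
    (halpha : modular_strip alpha) :
  [/\ affine_group_iso (crystG21 alpha 1) (crystA alpha 1),
      reflection_classes (crystG21 alpha 1) #= `I_4,
      reflection_classes (crystA alpha 1) #= `I_4,
      (forall n, (2 <= n)%N ->
         reflection_classes (crystG21 alpha n) #= `I_5)
    & (forall n, (2 <= n)%N ->
         reflection_classes (crystA alpha n) #= `I_1)].
Proof.
have [im_alpha _ _] := halpha; split.
- exact: crystG21_crystA_iso.
- exact: card_crystG21_1.
- exact: card_crystA_1.
- by move=> n; exact: card_crystG21.
- by move=> n; exact: card_crystA.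
Qed.
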